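(* Almost every positive integer is an $i$-congruent number; that is, $\lim_{x\to\infty}\frac{1}{x}\#\{1\le n\le x: n \text{ is an } i\text{-congruent number}\}=1$.
   Context: A positive integer $n$ is called an $i$-congruent number if it is the area of a right trapezoid with parallel sides $a>d$, height $b$ (perpendicular to the parallel sides) and slanted side $c$, where $a,b,c$ are positive integers, $d$ is a non-negative integer ($d=0$, a right triangle, is allowed) and $\gcd(b,c)=1$. Equivalently: there exist positive integers $a,b,c$ and an integer $d$ with $0\le d<a$ such that $n=\frac{(a+d)b}{2}$, $(a-d)^2+b^2=c^2$ and $\gcd(b,c)=1$. (The letter $i$ in the term ''$i$-congruent'' is part of the name and is not a parameter.) *)

(* Defs.v *)
From HB Require Import structures.
From mathcomp Require Import all_boot all_order all_algebra finmap.
From mathcomp Require Import all_classical all_reals all_analysis.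
Import Order.TTheory GRing.Theory Num.Theory.
Import numFieldNormedType.Exports.

Set Implicit Arguments.
Unset Strict Implicit.
Unset Printing Implicit Defensive.

Local Open Scope classical_set_scope.
Local Open Scope ring_scope.

(* [a] and [d] are the parallel sides (d = 0 giving a right triangle), [b] is
   the height and [c] the slanted side.  The area (a + d) b / 2 is compared
   with [n] in rat, so the division by 2 is exact.  The truncated subtraction
   [a - d] of nat is the true difference, since d < a. *)
Definition i_congruent (n : nat) : Prop :=
  exists a b c d : nat,
    [/\ (0 < a)%N, (0 < b)%N & (0 < c)%N] /\
    [/\ (d < a)%N,
        n%:R = (a + d)%N%:R * b%:R / 2 :> rat,
        ((a - d) ^ 2 + b ^ 2 = c ^ 2)%N
      & coprime b c].

(* The set below is bounded, hence finite, so [fset_set] (which is empty on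
   infinite sets) returns the finite set of its elements. *)
Definition i_congruent_count (R : realType) (x : R) : nat :=
  #|` fset_set [set n : nat | [/\ (1 <= n)%N, n%:R <= x & i_congruent n]]|%fset.

(* Main.v *)
Require Import Defs.
From HB Require Import structures.
From mathcomp Require Import all_boot all_order all_algebra finmap.
From mathcomp Require Import all_classical all_reals all_analysis.
From mathcomp Require Import zify ring lra.
Import Order.TTheory GRing.Theory Num.Theory.
Import numFieldNormedType.Exports.

Set Implicit Arguments.
Unset Strict Implicit.
Unset Printing Implicit Defensive.

Local Open Scope classical_set_scope.
Local Open Scope ring_scope.

(** An odd b >= 3 is a leg of the primitive triple
    (b, (b^2 - 1) / 2, (b^2 + 1) / 2).  If n = b m and b^2 - 1 <= 4 m, the
    trapezoid of height b with parallel sides m + (b^2 - 1) / 4 and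
    m - (b^2 - 1) / 4 has area n, and its slanted side is (b^2 + 1) / 2.  So a
    fixed odd b makes all of its large multiples i-congruent.

    It remains to see that almost every n has an odd divisor >= 3 below a
    suitable bound.  Let P be the product of the odd numbers s = 2 i + 1 with
    i < k, and let U be the set of numbers coprime to P, of density
    totient P / P.  The sets s U are pairwise disjoint: if s r = s' r' with
    r, r' in U, then s divides s' r' and is coprime to r', so s divides s', and
    conversely.  Their densities totient P / (P s) therefore add up to at
    most 1, that is, (totient P / P) * sum_i 1 / (2 i + 1) <= 1.  The sum
    diverges with k, so the density of U tends to 0.  A number n outside U is
    divisible by an odd prime p < 2 k, and is i-congruent once n >= (2 k)^3.
    For each k, the numbers that are not i-congruent thus have upper density
    at most totient P / P, which gives the result. *)

Lemma i_congruent_of_odd_divisor (b n : nat) :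
  odd b -> (3 <= b)%N -> (b %| n)%N -> (b ^ 3 <= 4 * n)%N -> i_congruent n.
Proof.
move=> b_odd b3 /dvdnP[m ->] le_b3.
pose t := b./2.
have def_b : b = (2 * t + 1)%N by rewrite -(odd_double_half b) b_odd /t; lia.
(* The leg (b^2 - 1) / 2 is 2 t (t + 1). *)
have le_tm : (t * t.+1 <= m)%N.
  have : (b ^ 2 <= 4 * m)%N.
    have b_gt0 : (0 < b)%N by lia.
    by rewrite -(leq_pmul2l b_gt0) -expnS; nia.
  by rewrite def_b; nia.
exists (m + t * t.+1)%N, b, (2 * (t * t.+1) + 1)%N, (m - t * t.+1)%N.
have subE : (m + t * t.+1 - (m - t * t.+1) = 2 * (t * t.+1))%N by lia.
split; first by split; nia.
split.
- by nia.
- have -> : (m + t * t.+1 + (m - t * t.+1) = 2 * m)%N by lia.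
  by rewrite !natrM; field.
- by rewrite subE def_b; nia.
(* The slanted side exceeds the other leg by 1, so b^2 is the sum of the two,
   two consecutive numbers. *)
- rewrite -(coprime_pexpl _ _ (isT : (0 < 2)%N)).
  have -> : (b ^ 2 = (2 * (t * t.+1) + 1) + 2 * (t * t.+1))%N by rewrite def_b; nia.
  by rewrite /coprime gcdnC gcdnDl addn1 -/(coprime _ _) coprimeSn.
Qed.

Lemma sum_over_multiples (s q : nat) (F : nat -> nat) : (0 < s)%N ->
  (\sum_(0 <= m < q * s) (if s %| m then F (m %/ s) else 0) =
   \sum_(0 <= r < q) F r)%N.
Proof.
move=> s_gt0; rewrite big_nat_mul; apply: eq_bigr => r _.
rewrite big_ltn ?ltn_pmul2r // dvdn_mull // mulnK // big_nat big1 /= ?addn0 //.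
move=> m /andP[lt_rm lt_mr]; case: ifP => // /dvdnP[k def_m].
by move: lt_rm lt_mr; rewrite def_m !ltn_pmul2r //; lia.
Qed.

Lemma sum_coprime_periods (P q : nat) :
  (\sum_(0 <= m < q * P) coprime P m = q * totient P)%N.
Proof.
rewrite big_nat_mul (eq_bigr (fun=> totient P)); last first.
  move=> r _; rewrite totient_count_coprime -{1}[(r * P)%N]add0n big_addn.
  have -> : (r.+1 * P - r * P = P)%N by rewrite mulSn addnK.
  by apply: eq_bigr => m _; rewrite /coprime addnC gcdnMDl.
by rewrite sum_nat_const_nat subn0.
Qed.

Lemma sum_coprime_le (P N : nat) : (0 < P)%N ->
  (\sum_(0 <= m < N) coprime P m <= (N %/ P).+1 * totient P)%N.
Proof.
move=> P_gt0; rewrite -sum_coprime_periods.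
by rewrite [leqRHS](big_cat_nat (n := N)) ?leq_addr //= ltnW // ltn_ceil.
Qed.

(** The disjointness of the sets of the multiples s r of s with r coprime
    to P, where s ranges over the divisors of P: two such s would divide each
    other. *)
Lemma coprime_cofactor_inj (P s s' m : nat) :
  (0 < s)%N -> (0 < s')%N ->
  (s %| P)%N -> (s' %| P)%N -> (s %| m)%N -> (s' %| m)%N ->
  coprime P (m %/ s) -> coprime P (m %/ s') -> s = s'.
Proof.
move=> s0 s'0 sP s'P sm s'm cs cs'; apply/eqP; rewrite eqn_dvd.
apply/andP; split.
- by rewrite -(Gauss_dvdl _ (coprime_dvdl sP cs')) mulnC divnK.
- by rewrite -(Gauss_dvdl _ (coprime_dvdl s'P cs)) mulnC divnK.
Qed.

(** The bound (totient P / P) * sum_(s <- S) 1 / s <= 1 with denominators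
    cleared.  It compares sizes inside an interval of length P * P, which for
    each divisor s of P is s times P / s full periods of coprimality to P;
    the term of s counts the m below P * P with s | m and m / s coprime
    to P. *)
Lemma totient_sum_divisors_le (P : nat) (S : seq nat) :
  (0 < P)%N -> uniq S -> all (dvdn^~ P) S ->
  (\sum_(s <- S) P %/ s * totient P <= P * P)%N.
Proof.
move=> P0 S_uniq /allP S_dvd.
have S_gt0 s : s \in S -> (0 < s)%N by move/S_dvd/dvdn_gt0; apply.
rewrite big_seq.
rewrite (eq_bigr (fun s => \sum_(0 <= m < P * P)
    (if s %| m then coprime P (m %/ s) : nat else 0)))%N; last first.
  move=> s sS; rewrite -sum_coprime_periods -(@sum_over_multiples s) ?S_gt0 //.
  by rewrite mulnAC divnK ?S_dvd.
rewrite -big_seq exchange_big /=.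
(* Each m is counted for at most one s. *)
apply: (@leq_trans (\sum_(0 <= m < P * P) 1)%N); last first.
  by rewrite sum_nat_const_nat subn0 muln1.
apply: leq_sum => m _.
have [/hasP[s sS /andP[sm cs]]|/hasPn none] :=
  boolP (has (fun s => (s %| m) && coprime P (m %/ s))%N S).
- rewrite (big_rem s) //= sm cs big_seq big1 // => s' .
  rewrite mem_rem_uniq // inE => /andP[s's s'S].
  case: ifP => // s'm; case cs' : (coprime _ _) => //.
  by case/eqP: s's; apply: (@coprime_cofactor_inj P s' s m); rewrite ?S_gt0 ?S_dvd.
- rewrite big_seq big1 // => s /none.
  by case: (s %| m)%N => //=; case: (coprime _ _).
Qed.

Definition odd_product (k : nat) : nat := (\prod_(i < k) (2 * i + 1))%N.

Lemma odd_product_gt0 k : (0 < odd_product k)%N.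
Proof. by rewrite prodn_gt0 // => i; rewrite addn1. Qed.

(** A common prime factor of n and a product of odd numbers below 2 k is an odd
    prime below 2 k, whose cube is small compared to n. *)
Lemma i_congruent_of_not_coprime (k n : nat) :
  ((2 * k) ^ 3 <= n)%N -> ~~ coprime (odd_product k) n -> i_congruent n.
Proof.
move=> le_kn; rewrite /coprime => gcd_neq1.
have gcd_gt1 : (1 < gcdn (odd_product k) n)%N.
  by rewrite ltn_neqAle eq_sym gcd_neq1 gcdn_gt0 odd_product_gt0.
have p_prime := pdiv_prime gcd_gt1.
have := pdiv_dvd (gcdn (odd_product k) n).
set p := pdiv _ in p_prime *; rewrite dvdn_gcd => /andP[].
rewrite /odd_product Euclid_dvd_prod // big_orE => /existsP[i p_dvd] pn.
have p_odd : odd p by apply: dvdn_odd p_dvd _; rewrite addn1 oddS mul2n odd_double.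
have p_le : (p <= 2 * k)%N.
  by apply: leq_trans (dvdn_leq _ p_dvd) _; have := ltn_ord i; lia.
apply: i_congruent_of_odd_divisor pn _ => //; first exact: odd_prime_gt2.
have : (p ^ 3 <= (2 * k) ^ 3)%N by rewrite leq_exp2r.
by lia.
Qed.

(** The comparison 1 / (i + 1) <= 2 / (2 i + 1) with the harmonic series. *)
Lemma sum_odd_reciprocals_unbounded (R : realType) (A : R) :
  exists k : nat, A <= \sum_(i < k) (2 * i + 1)%N%:R^-1.
Proof.
have : series (@harmonic R) @ \oo --> +oo.
  apply: nondecreasing_dvgn_lt (@dvg_harmonic R).
  by apply: nondecreasing_series => i _ _; exact: harmonic_ge0.
move/cvgryPge => /(_ (2 * A)) [k _ /(_ k (leqnn k)) /=].
rewrite seriesEord => leA; exists k.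
suff : \sum_(i < k) harmonic i <= 2 * \sum_(i < k) (2 * i + 1)%N%:R^-1 :> R.
  by move/(le_trans leA); rewrite ler_pM2l.
rewrite mulr_sumr; apply: ler_sum => i _.
rewrite /harmonic /= ler_pdivlMr ?ltr0n ?addn1 // mulrC ler_pdivrMr ?ltr0n //.
by rewrite -natrM ler_nat; lia.
Qed.

Lemma totient_odd_product_small (R : realType) (e : R) : 0 < e ->
  exists k : nat, (totient (odd_product k))%:R <= e * (odd_product k)%:R.
Proof.
move=> e0; have [k le_k] := sum_odd_reciprocals_unbounded e^-1.
exists k; set P := odd_product k.
have P0 : 0 < P%:R :> R by rewrite ltr0n odd_product_gt0.
have dvdP (i : 'I_k) : (2 * i + 1 %| P)%N by rewrite /P/odd_product (bigD1 i) //= dvdn_mulr.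
have := @totient_sum_divisors_le P [seq (2 * val i + 1)%N | i <- enum 'I_k]
  (odd_product_gt0 k).
rewrite map_inj_uniq ?enum_uniq; last by move=> i j /= ?; apply: val_inj => /=; lia.
move=> /(_ isT); rewrite all_map big_map big_enum /=.
have -> : all (preim (fun i : 'I_k => (2 * i + 1)%N) (dvdn^~ P)) (enum 'I_k).
  by apply/allP => i _ /=.
move=> /(_ isT); rewrite -(ler_nat R) natrM natr_sum.
under eq_bigr => i _ do rewrite natrM natf_div //.
rewrite -mulr_suml -mulr_sumr -mulrA ler_pM2l // => leP.
rewrite -ler_pdivrMl //; apply: le_trans leP.
by rewrite ler_wpM2r.
Qed.

Lemma i_congruent_countE (R : realType) (x : R) : 0 <= x ->
  i_congruent_count x =
  (\sum_(1 <= n < (Num.truncn x).+1) `[< i_congruent n >])%N.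
Proof.
move=> x0; rewrite /i_congruent_count.
set S := [seq n <- index_iota 1 (Num.truncn x).+1 | `[< i_congruent n >]].
have -> : [set n : nat | [/\ (1 <= n)%N, n%:R <= x & i_congruent n]] =
   [set` [fset n in S]%fset].
  apply/seteqP; split => n /=; rewrite inE /= mem_filter mem_index_iota.
  - by case=> n1 nx ni; rewrite n1 ltnS truncn_ge_nat // nx !andbT; apply/asboolP.
  - by case/andP=> /asboolP ni /andP[n1]; rewrite ltnS truncn_ge_nat.
rewrite set_fsetK card_fseq undup_id ?filter_uniq ?iota_uniq //.
by rewrite size_filter -sum1_count big_mkcond; apply: eq_bigr => n _; case: ifP.
Qed.

Lemma sum_ltn (N K : nat) : (\sum_(0 <= n < N) (n < K) = minn N K)%N.
Proof.
elim: N => [|N IH]; first by rewrite big_geq ?min0n.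
by rewrite big_nat_recr //= IH; lia.
Qed.

Theorem proposition1p2 (R : realType) :
  x^-1 * (i_congruent_count x)%:R @[x --> (+oo : set_system R)] --> (1 : R).
Proof.
apply/cvgrPdist_le => e e0.
have e2 : 0 < e / 2 by rewrite divr_gt0.
have [k le_k] := totient_odd_product_small e2.
set P := odd_product k in le_k.
have P0 : (0 < P)%N := odd_product_gt0 k.
(* The numbers up to x that are not i-congruent are the at most (2 k)^3 small
   ones, and those coprime to P, which number at most e / 2 * (x + 1) in the
   complete periods and totient P in the last one.  C collects what stays
   bounded, with 1 for rounding x down. *)
set C : R := 1 + ((2 * k) ^ 3)%N%:R + (totient P)%:R + e / 2.
near=> x.
have x0 : 0 < x by [].
have leCx : C <= e / 2 * x.
  by rewrite mulrC -ler_pdivrMr.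
rewrite i_congruent_countE ?(ltW x0) //.
set X := Num.truncn x; set c := (\sum_(1 <= n < X.+1) _)%N.
have /andP[leXx ltxX] : X%:R <= x < X.+1%:R by apply: truncn_itv; exact: ltW.
have le_cX : (c <= X)%N.
  apply: (@leq_trans (\sum_(1 <= n < X.+1) 1)%N).
    by apply: leq_sum => n _; case: asbool.
  by rewrite sum_nat_const_nat muln1 subSS subn0.
have le_Xc : (X <= c + (2 * k) ^ 3 + \sum_(0 <= n < X.+1) coprime P n)%N.
  apply: (@leq_trans (\sum_(1 <= n < X.+1)
      (`[< i_congruent n >] + (n < (2 * k) ^ 3) + coprime P n))%N).
    apply: (@leq_trans (\sum_(1 <= n < X.+1) 1)%N).
      by rewrite sum_nat_const_nat muln1 subSS subn0.
    apply: leq_sum => n _.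
    case: (ltnP n) => [_|le_kn]; first by rewrite addn1 addSn.
    have [//|nP] := boolP (coprime P n); first by rewrite leq_addl.
    by rewrite (asboolT (i_congruent_of_not_coprime le_kn nP)).
  rewrite !big_split /= leq_add //.
    rewrite leq_add2l (leq_trans _ (geq_minr X.+1 ((2 * k) ^ 3))) //.
    by rewrite -sum_ltn (big_ltn (ltn0Sn X)) leq_addl.
  by rewrite [leqRHS](big_ltn (ltn0Sn X)) leq_addl.
have le_cop := sum_coprime_le X.+1 P0.
have le_per : ((X.+1 %/ P) * totient P)%N%:R <= e / 2 * X.+1%:R.
  rewrite natrM; apply: le_trans (ler_wpM2l (ler0n _ _) le_k) _.
  by rewrite mulrCA -natrM ler_wpM2l ?(ltW e2) // ler_nat leq_trunc_div.
have le_Xc' : X%:R <= c%:R + ((2 * k) ^ 3)%N%:R +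
    ((X.+1 %/ P) * totient P)%N%:R + (totient P)%:R :> R.
  by rewrite -!natrD ler_nat; move: le_Xc le_cop; rewrite mulSn; lia.
have lec : c%:R <= x by apply: le_trans leXx; rewrite ler_nat.
have gec : x - e * x <= c%:R.
  have : e / 2 * X.+1%:R <= e / 2 * (x + 1).
    by rewrite ler_wpM2l ?(ltW e2) // -natr1 lerD2r.
  move: leCx ltxX le_Xc' le_per; rewrite /C -(natr1 X).
  lra.
have -> : 1 - x^-1 * c%:R = (x - c%:R) / x by field; exact: lt0r_neq0.
rewrite ger0_norm ?ler_pdivrMr //; first by lra.
by rewrite divr_ge0 ?(ltW x0) // subr_ge0.
Unshelve. all: by end_near.
Qed.
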